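(* Let $n=|V|$ and let $\mathcal F$ be the flow semigroup of a finite set $A$ of capacity constraints on $V$. For every nonempty word $w\in\mathcal F^*$ there is a $\sharp$-summary of $w$ of height at most $536\,n^{12}$.
   Context: $V$ is a finite set of vertices with two distinct distinguished vertices $v_s,v_t$. A capacity constraint is $a\in(\mathbb N\cup\{\omega\})^{V\times V}$ with $a(v,v')=0$ whenever $v'=v_s$ or $v=v_t$; $A$ is a finite set of capacity constraints. Order $0<1<\omega$. On $\{0,1,\omega\}^{V\times V}$ use the max-min matrix product $(x\cdot y)(v,v')=\max_{v''\in V}\min(x(v,v''),y(v'',v'))$. For $a\in A$ let $x_a\in\{0,1,\omega\}^{V\times V}$ be obtained from $a$ by keeping $0$ and $\omega$ and replacing each finite positive entry by $1$. For an idempotent $e=e\cdot e$, a pair $(v,v')$ with $e(v,v')=1$ is unstable if there exist $v_0,v_0'\in V$ with $e(v,v_0)=\omega$, $e(v_0,v_0')=1$, $e(v_0',v')=\omega$, and stable otherwise. The iteration $e^\sharp$ is the matrix with $e^\sharp(v,v')=\omega$ if $e(v,v')=1$ and $(v,v')$ is unstable, and $e^\sharp(v,v')=e(v,v')$ otherwise. The flow semigroup $\mathcal F$ is the smallest subset of $\{0,1,\omega\}^{V\times V}$ containing $\{x_a: a\in A\}$ and closed under product and under $e\mapsto e^\sharp$ for idempotents $e$. A $\sharp$-summary of a word $w\in\mathcal F^*$ is an ordered binary tree with nodes labeled in $\mathcal F\times\mathcal F^*$, with three types of nodes (recursive definition): (1) a leaf, labeled $(x,x)$ for some $x\in\mathcal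 F$; (2) a product node, with two children labeled $(x_1,u_1)$, $(x_2,u_2)$, and label $(x_1\cdot x_2,u_1u_2)$; (3) an idempotent node, with two children labeled $(e,u_1)$, $(e,u_2)$ where $e$ is an idempotent of $\mathcal F$, and label $(e^\sharp,u_1w_1\cdots w_mu_2)$ for some $w_1,\dots,w_m\in\mathcal F^*$ such that each $w_i$ has a $\sharp$-summary whose root is labeled $(e,w_i)$. The root is labeled $(x,w)$ for some $x\in\mathcal F$. The height of a tree consisting of a single leaf is $0$. *)

(* Defs.v *)
From mathcomp Require Import all_boot all_order finmap.

Set Implicit Arguments.
Unset Strict Implicit.
Unset Printing Implicit Defensive.

(* Entries in N + {omega}: [Some k] is the integer k, [None] is omega. *)
Notation constraint V := {ffun V * V -> option nat}.

Definition capacity_constraint (V : finType) (vs vt : V) (a : constraint V) :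
    Prop :=
  forall v v' : V, v' = vs \/ v = vt -> a (v, v') = Some 0.

(* The chain 0 < 1 < omega is 'I_3 with its canonical order. *)
Notation flow V := {ffun V * V -> 'I_3}.

Definition fzero : 'I_3 := @Ordinal 3 0 isT.
Definition fone : 'I_3 := @Ordinal 3 1 isT.
Definition fomega : 'I_3 := @Ordinal 3 2 isT.

Definition capacity_abs (c : option nat) : 'I_3 :=
  match c with
  | Some 0 => fzero
  | Some _.+1 => fone
  | None => fomega
  end.

Definition flow_of_constraint (V : finType) (a : constraint V) : flow V :=
  [ffun p => capacity_abs (a p)].

Definition flow_mul (V : finType) (x y : flow V) : flow V :=
  [ffun p => \big[Order.max/fzero]_(v : V)
               Order.min (x (p.1, v)) (y (v, p.2))].

Definition flow_idempotent (V : finType) (e : flow V) : bool :=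
  flow_mul e e == e.

Definition unstable (V : finType) (e : flow V) (v v' : V) : bool :=
  (e (v, v') == fone) &&
  [exists v0 : V, exists v0' : V,
    [&& e (v, v0) == fomega, e (v0, v0') == fone & e (v0', v') == fomega]].

(* Defined on every matrix, but only used on idempotents. *)
Definition flow_sharp (V : finType) (e : flow V) : flow V :=
  [ffun p => if unstable e p.1 p.2 then fomega else e p].

Inductive flow_semigroup (V : finType) (A : {fset constraint V}) :
    flow V -> Prop :=
| FlowGen a : a \in A -> flow_semigroup A (flow_of_constraint a)
| FlowMul x y : flow_semigroup A x -> flow_semigroup A y ->
    flow_semigroup A (flow_mul x y)
| FlowSharp e : flow_semigroup A e -> flow_idempotent e ->
    flow_semigroup A (flow_sharp e).

Definition flow_word (V : finType) (A : {fset constraint V})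
    (w : seq (flow V)) : Prop :=
  forall x, x \in w -> flow_semigroup A x.

Inductive btree (L : Type) : Type :=
| Leaf of L
| Node of L & btree L & btree L.

Definition label (L : Type) (t : btree L) : L :=
  match t with Leaf l => l | Node l _ _ => l end.

Fixpoint height (L : Type) (t : btree L) : nat :=
  match t with
  | Leaf _ => 0
  | Node _ t1 t2 => (maxn (height t1) (height t2)).+1
  end.

(* In [SumIdem] the list [ws] of middle factors may be empty, and their
   summaries are not subtrees, so they do not count in the height.  That labels
   lie in the flow semigroup and its words is [sharp_summary_label]. *)
Inductive sharp_summary (V : finType) (A : {fset constraint V}) :
    btree (flow V * seq (flow V)) -> Prop :=
| SumLeaf x : flow_semigroup A x -> sharp_summary A (Leaf (x, [:: x]))
| SumProd x1 u1 x2 u2 t1 t2 :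
    sharp_summary A t1 -> label t1 = (x1, u1) ->
    sharp_summary A t2 -> label t2 = (x2, u2) ->
    sharp_summary A (Node (flow_mul x1 x2, u1 ++ u2) t1 t2)
| SumIdem e u1 u2 (ws : seq (seq (flow V))) t1 t2 :
    flow_idempotent e ->
    sharp_summary A t1 -> label t1 = (e, u1) ->
    sharp_summary A t2 -> label t2 = (e, u2) ->
    (forall w, w \in ws ->
       exists t, sharp_summary A t /\ label t = (e, w)) ->
    sharp_summary A (Node (flow_sharp e, u1 ++ flatten ws ++ u2) t1 t2).

Lemma sharp_summary_label (V : finType) (A : {fset constraint V})
    (t : btree (flow V * seq (flow V))) :
  sharp_summary A t ->
  flow_semigroup A (label t).1 /\ flow_word A (label t).2.
Proof.
move: t; fix IH 2 => t [x Fx | x1 u1 x2 u2 t1 t2 S1 L1 S2 L2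
  | e u1 u2 ws t1 t2 ee S1 L1 S2 L2 Sw] /=.
- by split=> // y; rewrite inE => /eqP ->.
- have [] := IH _ S1; have [] := IH _ S2; rewrite L1 L2 /= => F2 W2 F1 W1.
  split; first exact: FlowMul.
  by move=> y; rewrite mem_cat => /orP[/W1 | /W2].
- have Ww w : w \in ws -> flow_word A w.
    move=> ws_w; destruct (Sw w ws_w) as [t' [S' L']].
    by have := proj2 (IH t' S'); rewrite L'.
  have [] := IH _ S1; have [] := IH _ S2; rewrite L1 L2 /= => F2 W2 F1 W1.
  split; first exact: FlowSharp.
  move=> y; rewrite !mem_cat => /or3P[/W1 // | /flattenP[w ws_w yw] | /W2 //].
  exact: Ww yw.
Qed.

(* Main.v *)
(* Attach to an idempotent e the number of pairs (C, D) of strongly connected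
   components of reflexive vertices with C = D or no edge from C to D, summed
   over the two relations [0 < e] and [1 < e].  This rank is at most 2 n^2, it is
   monotone for the J-order on idempotents, and it is strictly monotone for
   e g = g = g e; in particular e^sharp has smaller rank unless e^sharp = e.

   The summary is built in 2 n^2 + 1 stages.  After the stage of rank k, the word
   is cut into items, each with a summary of bounded height, and every factor of
   at least 2^r items has a value lying J-below an idempotent of rank less than k.
   To go one rank down, replace blocks of items by idempotent nodes of rank k,
   whose outer children have at most 2^(r + O(n^2)) items, until the number of
   segments is minimal.  A long factor that does not drop in rank would then either
   contain two short consecutive blocks with the same idempotent value, or meet
   some e^sharp = e so often that two of its occurrences, together with everything
   between them, have value e; in both cases the segmentation can be shortened.
   The Ramsey argument behind this needs only words of length 2^(O(n^2)), because
   within one rank every factor fixing a prefix lies in a maximal subgroup.  Hence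
   r = O(n^4), and the height is O(n^6). *)

Require Import Defs.
From mathcomp Require Import all_boot all_order finmap.
From mathcomp Require Import zify.
From Stdlib Require Import Classical_Prop.

Set Implicit Arguments.
Unset Strict Implicit.
Unset Printing Implicit Defensive.

(** * Ranks of idempotent relations *)

Section Relations.

Variable V : finType.
Implicit Types (r s e f g : rel V) (x y z : V).

Definition relmul r s : rel V := fun x y => [exists z, r x z && s z y].

Definition relidem r := relmul r r =2 r.

Lemma relmulP r s x y :
  reflect (exists2 z, r x z & s z y) (relmul r s x y).
Proof.
by apply: (iffP existsP) => [[z /andP[]]|[z rxz szy]]; exists z => //; apply/andP.
Qed.

Lemma relmulA r s e : relmul r (relmul s e) =2 relmul (relmul r s) e.
Proof.
move=> x y; apply/relmulP/relmulP.
  by move=> [z rxz /relmulP[t szt ety]]; exists t => //; apply/relmulP; exists z.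
by move=> [z /relmulP[t rxt stz] ezy]; exists t => //; apply/relmulP; exists z.
Qed.

Lemma relidem_trans r x y z : relidem r -> r x y -> r y z -> r x z.
Proof. by move=> ri rxy ryz; rewrite -ri; apply/relmulP; exists y. Qed.

(* Among the interpolants between x and y, one with fewest successors is
   reflexive. *)
Lemma relidem_interpolant f x y :
  relidem f -> f x y -> exists z, [/\ f z z, f x z & f z y].
Proof.
move=> fi fxy.
have [z0 fxz0 fz0y] : exists2 z, f x z & f z y by apply/relmulP; rewrite fi.
have P0 : f x z0 && f z0 y by rewrite fxz0.
case: (@arg_minnP _ z0 (fun z => f x z && f z y)
  (fun z => #|[set t | f z t]|) P0) => z /andP[fxz fzy] zmin.
have [t fzt fty] : exists2 t, f z t & f t y by apply/relmulP; rewrite fi.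
have fxt := relidem_trans fi fxz fzt.
have sub : [set u | f t u] \subset [set u | f z u].
  by apply/subsetP => u; rewrite !inE; exact: relidem_trans fzt.
have eqs : [set u | f t u] = [set u | f z u].
  by apply/eqP; rewrite eqEcard sub zmin // fxt fty.
exists t; split=> //.
by have : t \in [set u | f z u] by [rewrite inE]; rewrite -eqs inE.
Qed.

(* A canonical vertex of the strongly connected component of x: it depends only
   on the component. *)
Definition scc_rep r x := odflt x [pick y | r x y && r y x].

Definition scc_reps r := [set x | r x x && (scc_rep r x == x)].

Definition incomparable_reps r :=
  [set p in setX (scc_reps r) (scc_reps r) | (p.1 == p.2) || ~~ r p.1 p.2].

Lemma in_incomparable r x y : ((x, y) \in incomparable_reps r) =
  [&& x \in scc_reps r, y \in scc_reps r & (x == y) || ~~ r x y].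
Proof. by rewrite inE in_setX -andbA. Qed.

Definition rel_rank r := #|incomparable_reps r|.

Lemma rel_rank_le r : rel_rank r <= #|V| ^ 2.
Proof. by rewrite -mulnn -card_prod /rel_rank max_card. Qed.

Lemma scc_repE r x y : relidem r -> r x y -> r y x -> scc_rep r x = scc_rep r y.
Proof.
move=> ri rxy ryx; rewrite /scc_rep.
rewrite (@eq_pick _ _ (fun z => r y z && r z y)); last first.
  move=> z; apply/andP/andP => -[rz zr]; split.
  - exact: relidem_trans rz.
  - exact: relidem_trans rxy.
  - exact: relidem_trans rz.
  - exact: relidem_trans ryx.
by case: pickP => // /(_ x); rewrite rxy ryx.
Qed.

Lemma scc_repP r x : r x x -> r x (scc_rep r x) /\ r (scc_rep r x) x.
Proof.
by move=> rxx; rewrite /scc_rep; case: pickP => [z /andP[]|/(_ x)] //; rewrite rxx.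
Qed.

Lemma scc_reps_exists r x :
  relidem r -> r x x -> exists z, [/\ z \in scc_reps r, r x z & r z x].
Proof.
move=> ri rxx; have [rxz rzx] := scc_repP rxx.
exists (scc_rep r x); split=> //; rewrite inE (relidem_trans ri rzx rxz) /=.
by apply/eqP; apply: scc_repE.
Qed.

Lemma scc_reps_antisym r x y :
  relidem r -> x \in scc_reps r -> y \in scc_reps r -> r x y -> r y x -> x = y.
Proof.
rewrite !inE => ri /andP[_ /eqP xE] /andP[_ /eqP yE] rxy ryx.
by rewrite -xE -yE; apply: scc_repE.
Qed.

(** An [f]-edge can be inserted in the middle of the cycle through [z]. A reflexive interpolant of
    this edge lies in a component of [f], whose representative is returned. *)
Lemma scc_reps_factor f (al be : rel V) z :
  relidem f -> relmul al f =2 al -> relmul f be =2 be -> relmul al be z z ->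
  exists t, [&& t \in scc_reps f, al z t & be t z].
Proof.
move=> fi alf fbe /relmulP[p alzp bepz].
have [q alzq fqp] : exists2 q, al z q & f q p by apply/relmulP; rewrite alf.
have [t [ftt fqt ftp]] := relidem_interpolant fi fqp.
have [u [uf ftu fut]] := scc_reps_exists fi ftt.
exists u; rewrite uf -alf -fbe /=; apply/andP; split; apply/relmulP.
  by exists q => //; apply: relidem_trans ftu.
by exists p => //; apply: relidem_trans ftp.
Qed.

(** * Comparison of ranks through a map of components *)

Section RankMap.

Variables (e f : rel V) (phi : V -> V).
Hypotheses (ei : relidem e)
  (phi_reps : {in scc_reps e, forall z, phi z \in scc_reps f})
  (phi_refl : {in scc_reps e &, forall z t, f (phi z) (phi t) -> e z t}).

Let pairmap (p : V * V) := (phi p.1, phi p.2).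

(** The loop of [f] at a common image is reflected to edges in both directions between [z] and
    [t]. *)
Lemma scc_map_inj : {in scc_reps e &, injective phi}.
Proof.
move=> z t ze te eqphi.
have ff : f (phi t) (phi t) by have := phi_reps te; rewrite inE => /andP[].
by apply: (scc_reps_antisym ei ze te); apply: phi_refl; rewrite ?eqphi.
Qed.

Lemma scc_pairmap_inj : {in incomparable_reps e &, injective pairmap}.
Proof.
move=> [z t] [z' t']; rewrite !in_incomparable => /and3P[ze te _] /and3P[ze' te' _].
by move=> [] /scc_map_inj -> // /scc_map_inj ->.
Qed.

Lemma scc_pairmap_sub :
  pairmap @: incomparable_reps e \subset incomparable_reps f.
Proof.
apply/subsetP => _ /imsetP[[z t] + ->].
rewrite !in_incomparable => /and3P[ze te inc]; rewrite !phi_reps //=.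
case/orP: inc => [/eqP->|nezt]; first by rewrite eqxx.
by apply/orP; right; apply: contra nezt; apply: phi_refl.
Qed.

Lemma rel_rank_le_map : rel_rank e <= rel_rank f.
Proof.
by rewrite /rel_rank -(card_in_imset scc_pairmap_inj) subset_leq_card ?scc_pairmap_sub.
Qed.

(** Equal cardinalities make [pairmap] onto. Diagonal pairs then give surjectivity of [phi], and a
    non-edge between two images can only come from an incomparable pair. *)
Lemma rel_rank_eq_map : rel_rank e = rel_rank f ->
  [/\ {in scc_reps f, forall y, exists2 z, z \in scc_reps e & y = phi z}
     & {in scc_reps e &, forall z t, e z t -> f (phi z) (phi t)}].
Proof.
move=> eqr.
have imE : pairmap @: incomparable_reps e = incomparable_reps f.
  apply/eqP; rewrite eqEcard scc_pairmap_sub (card_in_imset scc_pairmap_inj).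
  by rewrite -[X in X <= _]eqr /=.
split=> [y yf|z t ze te ezt].
  have : (y, y) \in incomparable_reps f by rewrite in_incomparable eqxx yf.
  rewrite -imE => /imsetP[[z t] + [-> _]].
  by rewrite in_incomparable => /and3P[ze _ _]; exists z.
apply/negPn/negP => nf.
have : (phi z, phi t) \in incomparable_reps f.
  by rewrite in_incomparable !phi_reps //= nf orbT.
rewrite -imE => /imsetP[[z' t'] + []].
rewrite in_incomparable => /and3P[ze' te' inc].
move=> /scc_map_inj ez /scc_map_inj et; move: inc; rewrite -ez // -et // ezt orbF.
move=> /eqP zt; move: nf; rewrite zt.
by have := phi_reps te; rewrite inE => /andP[->].
Qed.

End RankMap.

(** [phi z] is a representative for [f] on a cycle through [z]. Edges are reflected by the path from
    [z] to [phi z], to [phi t], to [t]. *)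
Lemma scc_map_exists e f (al be : rel V) :
  relidem e -> relidem f -> relmul al f =2 al -> relmul f be =2 be ->
  relmul al be =2 e ->
  exists phi : V -> V, [/\
    {in scc_reps e, forall z, [/\ phi z \in scc_reps f, al z (phi z) & be (phi z) z]} &
    {in scc_reps e &, forall z t, f (phi z) (phi t) -> e z t}].
Proof.
move=> ei fi alf fbe albe.
pose phi z := odflt z [pick t | [&& t \in scc_reps f, al z t & be t z]].
have phiP : {in scc_reps e,
    forall z, [/\ phi z \in scc_reps f, al z (phi z) & be (phi z) z]}.
  move=> z; rewrite inE => /andP[ezz _]; rewrite -albe in ezz.
  have [t Pt] := scc_reps_factor fi alf fbe ezz.
  by rewrite /phi; case: pickP => [u /and3P[]|/(_ t)]; rewrite ?Pt.
exists phi; split=> // z t /phiP[_ alz _] /phiP[_ _ bet] fphi.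
rewrite -albe; apply/relmulP; exists (phi z) => //.
by rewrite -fbe; apply/relmulP; exists (phi t).
Qed.

Lemma rel_rank_le_factor e f (al be : rel V) :
  relidem e -> relidem f -> relmul al f =2 al -> relmul f be =2 be ->
  relmul al be =2 e -> rel_rank e <= rel_rank f.
Proof.
move=> ei fi alf fbe albe.
have [phi [phiP phi_refl]] := scc_map_exists ei fi alf fbe albe.
by apply: (@rel_rank_le_map e f phi) => // z /phiP[].
Qed.

(** Take [g] for both factors. Equality of ranks makes [phi] onto, so [g] is reflexive at every
    representative of [e]. It also makes [phi] preserve edges, which turns [g]-edges between
    representatives into [e]-edges. *)
Lemma rel_rank_eq_below e g :
  relidem e -> relidem g -> relmul g e =2 g -> relmul e g =2 g ->
  rel_rank g = rel_rank e -> g =2 e.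
Proof.
move=> ei gi ge eg eqr.
have [phi [phiP phi_refl]] := scc_map_exists gi ei ge eg gi.
have phi_reps : {in scc_reps g, forall z, phi z \in scc_reps e} by move=> z /phiP[].
have [surj mono] := rel_rank_eq_map gi phi_reps phi_refl eqr.
have e_sub x y : e x y -> g x y.
  move=> /(relidem_interpolant ei)[t [ett ext ety]].
  have [r [re etr ert]] := scc_reps_exists ei ett.
  have [z zg rE] := surj r re; have [_ gzr grz] := phiP z zg; rewrite -rE in gzr grz.
  rewrite -ge; apply/relmulP; exists r; last exact: relidem_trans ety.
  rewrite -eg; apply/relmulP; exists r; first exact: relidem_trans etr.
  exact: relidem_trans gzr.
move=> x y; apply/idP/idP => [gxy|/e_sub //].
(* Writing [g] as [e g e] makes an edge of [g] pass through two representatives of [e]. *)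
have egxy : relmul e (relmul g e) x y.
  apply/relmulP.
  have [p exp gpy] : exists2 p, e x p & g p y by apply/relmulP; rewrite eg.
  by exists p; rewrite ?ge.
move/relmulP: egxy => [p exp /relmulP[q gpq eqy]].
have [p' [epp' exp' ep'p]] := relidem_interpolant ei exp.
have [q' [eqq' eqq eq'y]] := relidem_interpolant ei eqy.
have [r [re epr erp]] := scc_reps_exists ei epp'.
have [s [se eqs esq]] := scc_reps_exists ei eqq'.
have grs : g r s.
  rewrite -eg; apply/relmulP; exists p; first exact: relidem_trans ep'p.
  by rewrite -ge; apply/relmulP; exists q => //; apply: relidem_trans eqs.
have [z zg rE] := surj r re; have [_ gzr grz] := phiP z zg; rewrite -rE in gzr grz.
have [t tg sE] := surj s se; have [_ gts gst] := phiP t tg; rewrite -sE in gts gst.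
have ers : e r s.
  rewrite rE sE; apply: mono => //.
  by apply: relidem_trans gzr _ => //; apply: relidem_trans gst.
apply: (relidem_trans ei exp'); apply: (relidem_trans ei epr).
apply: (relidem_trans ei ers); exact: relidem_trans eq'y.
Qed.

End Relations.

(** * Sequences *)

Definition slice (T : Type) i j (s : seq T) := take (j - i) (drop i s).

Lemma slice_cat (T : Type) i j l (s : seq T) :
  i <= j -> j <= l -> slice i l s = slice i j s ++ slice j l s.
Proof.
move=> ij jl; rewrite /slice (_ : l - i = (j - i) + (l - j)); last by lia.
by rewrite takeD drop_drop subnK.
Qed.

Lemma slice_neq0 (T : eqType) i j (s : seq T) :
  i < j -> j <= size s -> slice i j s != [::].
Proof.
by move=> ij js; rewrite -size_eq0 /slice size_takel ?size_drop; lia.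
Qed.

Lemma size_sum_count_mem (T : finType) (s : seq T) :
  size s = \sum_v count_mem v s.
Proof.
elim: s => [|x s IH] /=; first by rewrite big1.
rewrite big_split /= -IH (bigD1 x) //= eqxx big1 // => v.
by rewrite eq_sym => /negPf->.
Qed.

Lemma pigeonhole_mem (T : finType) (s : seq T) K :
  #|T| * K < size s -> exists v, K < count_mem v s.
Proof.
move=> lt_s; apply/existsP; apply: contraLR lt_s.
rewrite negb_exists => /forallP cnt.
rewrite -leqNgt size_sum_count_mem -sum_nat_const.
by apply: leq_sum => v _; rewrite leqNgt.
Qed.

Lemma pigeonhole_positions (T : finType) (f : nat -> T) m N K :
  #|T| * K < N -> exists v I, [/\ K < size I, sorted ltn I &
    {in I, forall i, m <= i < m + N /\ f i = v}].
Proof.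
move=> lt_N; have [v Kv] : exists v, K < count_mem v [seq f i | i <- iota m N].
  by apply: pigeonhole_mem; rewrite size_map size_iota.
exists v, [seq i <- iota m N | f i == v]; split.
- by rewrite size_filter -(count_map f (pred1 v)).
- by apply: sorted_filter (iota_ltn_sorted m N); apply: ltn_trans.
- by move=> i; rewrite mem_filter mem_iota => /andP[/eqP].
Qed.

Lemma map_eq_cat (T T' : Type) (f : T -> T') (L : seq T) z1 z2 :
  map f L = z1 ++ z2 ->
  exists L1 L2, [/\ L = L1 ++ L2, map f L1 = z1 & map f L2 = z2].
Proof.
move=> fL; exists (take (size z1) L), (drop (size z1) L).
by rewrite cat_take_drop map_take map_drop fL take_size_cat // drop_size_cat.
Qed.

(** Cut [s] into chunks of length [B]: either one of them avoids [P], or each contributes to the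
    count. The successor pays for the last chunk. *)
Lemma run_or_count (T : Type) (P : pred T) B (s : seq T) :
  (exists s1 s2 s3, [/\ s = s1 ++ s2 ++ s3, size s2 = B & all (predC P) s2]) \/
  size s <= B * (count P s).+1.
Proof.
case: (posnP B) => [->|B0]; first by left; exists [::], [::], s.
have [n] := ubnP (size s); elim: n s => // n IH s lt_s.
case: (leqP (size s) B) => [leB|ltB].
  by right; rewrite (leq_trans leB) // leq_pmulr.
case: (boolP (has P (take B s))) => [hasP|]; last first.
  rewrite -all_predC => allP; left; exists [::], (take B s), (drop B s).
  by rewrite cat_take_drop size_takel // ltnW.
have [|[s1 [s2 [s3 [sE sB sP]]]]|le_d] := IH (drop B s).
- by rewrite size_drop; lia.
- left; exists (take B s ++ s1), s2, s3; split=> //.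
  by rewrite -catA -sE cat_take_drop.
- right; rewrite -{2}(cat_take_drop B s) count_cat.
  move: hasP le_d; rewrite has_count size_drop; nia.
Qed.

Lemma cut_before (T : Type) (P : pred T) N (s : seq T) : N <= count P s ->
  exists s0 L, [/\ s = s0 ++ flatten L, size L = N &
    all (fun l => if l is q :: _ then P q else false) L].
Proof.
elim: s N => [|x s IH] N /=; first by case: N => // _; exists [::], [::].
case: (boolP (P x)) => [Px|_]; last first.
  rewrite add0n => /IH[s0 [L [-> sL aL]]]; by exists (x :: s0), L.
case: N => [_|N]; first by exists (x :: s), [::]; rewrite cats0.
rewrite add1n ltnS => /IH[s0 [L [-> sL aL]]].
by exists [::], ((x :: s0) :: L); rewrite /= sL Px.
Qed.

(** * The monoid of flows *)

Section FlowMonoid.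

Variable V : finType.
Implicit Types (x y a b c d e f g : flow V).

Local Notation "x ** y" := (flow_mul x y) (at level 40, left associativity).

(* The two thresholds: [above false x] is [0 < x] and [above true x] is [x = omega]. *)
Definition above (i : bool) x : rel V := fun v v' => i < x (v, v').

Lemma above_ext x y : (forall i, above i x =2 above i y) -> x = y.
Proof.
move=> xy; apply/ffunP => -[v v']; apply: val_inj.
have := xy false v v'; have := xy true v v'; rewrite /above /=.
by case: (x _) => [[|[|[|?]]] ?] //; case: (y _) => [[|[|[|?]]] ?].
Qed.

(** Thresholding is a lattice morphism from the chain to the booleans, so the max-min product
    becomes composition of relations. *)
Lemma above_mul i x y : above i (x ** y) =2 relmul (above i x) (above i y).
Proof.
move=> v v'; rewrite /above ffunE /=.
rewrite (@big_morph _ _ (fun k : 'I_3 => i < k) false orb) //; last first.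
  by move=> k l; rewrite /Order.max Order.OrdinalOrder.ltEord; case: (ltnP k l); lia.
rewrite big_orE; apply: eq_existsb => v''.
rewrite /Order.min Order.OrdinalOrder.ltEord.
by case: (ltnP (x _) (y _)); lia.
Qed.

Lemma eq_relmul (r r' s s' : rel V) :
  r =2 r' -> s =2 s' -> relmul r s =2 relmul r' s'.
Proof. by move=> rr ss v v'; apply: eq_existsb => v''; rewrite rr ss. Qed.

Lemma flow_mulA x y z : x ** (y ** z) = x ** y ** z.
Proof.
apply: above_ext => i v v'; rewrite !above_mul.
rewrite (eq_relmul (fun _ _ => erefl) (above_mul i y z)) relmulA.
by apply: eq_relmul => // ? ?; rewrite above_mul.
Qed.

Definition flow_one : flow V := [ffun p => if p.1 == p.2 then fomega else fzero].

Lemma above_one i v v' : above i flow_one v v' = (v == v').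
Proof. by rewrite /above ffunE /=; case: eqP; case: i. Qed.

Lemma flow_mul1 x : flow_one ** x = x.
Proof.
apply: above_ext => i v v'; rewrite above_mul; apply/relmulP/idP.
  by move=> [u]; rewrite above_one => /eqP <-.
by move=> xv; exists v; rewrite ?above_one.
Qed.

Lemma flow_mulr1 x : x ** flow_one = x.
Proof.
apply: above_ext => i v v'; rewrite above_mul; apply/relmulP/idP.
  by move=> [u] xvu; rewrite above_one => /eqP <-.
by move=> xv; exists v'; rewrite ?above_one.
Qed.

Lemma above_idem i e : e ** e = e -> relidem (above i e).
Proof. by move=> ee v v'; rewrite -above_mul ee. Qed.

Definition flow_rank x := rel_rank (above false x) + rel_rank (above true x).

Lemma flow_rank_le x : flow_rank x <= 2 * #|V| ^ 2.
Proof. by rewrite mul2n -addnn leq_add ?rel_rank_le. Qed.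

Lemma flow_rank_factor e f a b :
  e ** e = e -> f ** f = f -> e = a ** f ** b -> flow_rank e <= flow_rank f.
Proof.
move=> ee ff eE.
have le_above i : rel_rank (above i e) <= rel_rank (above i f).
  apply: (@rel_rank_le_factor _ _ _ (above i (a ** f)) (above i (f ** b)));
    try (by apply: above_idem); move=> v v'; rewrite -above_mul.
  - by rewrite -flow_mulA ff.
  - by rewrite flow_mulA ff.
  - by rewrite flow_mulA -(flow_mulA a) ff -eE.
exact: leq_add.
Qed.

(** At each threshold the rank of [g] is at most that of [e], so the inequality between the sums
    forces equality at both. *)
Lemma flow_rank_eq_below e g :
  e ** e = e -> g ** g = g -> g ** e = g -> e ** g = g ->
  flow_rank e <= flow_rank g -> g = e.
Proof.
move=> ee gg ge eg le_rank.
have le_above i : rel_rank (above i g) <= rel_rank (above i e).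
  apply: (@rel_rank_le_factor _ _ _ (above i g) (above i g));
    try (by apply: above_idem); move=> v v'; by rewrite -above_mul ?ge ?eg ?gg.
have eq_above i : rel_rank (above i g) = rel_rank (above i e).
  apply/eqP; rewrite eqn_leq le_above /=; move: le_rank (le_above (~~ i)).
  by rewrite /flow_rank; case: i => /=; lia.
apply: above_ext => i; apply: rel_rank_eq_below => //; try (by apply: above_idem).
- by move=> v v'; rewrite -above_mul ge.
- by move=> v v'; rewrite -above_mul eg.
Qed.

(** Instability asks for a middle entry equal to 1. Allowing omega there only adds pairs already at
    omega, by transitivity; conversely a pair at omega passes through a vertex reflexive for
    [above true e]. *)
Lemma flow_sharpE e : e ** e = e ->
  (above false (flow_sharp e) =2 above false e) /\
  (above true (flow_sharp e) =2
     relmul (above true e) (relmul (above false e) (above true e))).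
Proof.
move=> ee; have i0 := above_idem false ee; have i1 := above_idem true ee.
have sub v v' : above true e v v' -> above false e v v'.
  by rewrite /above; lia.
have eval v v' : e (v, v') = if above true e v v' then fomega
    else if above false e v v' then fone else fzero.
  by apply: val_inj; rewrite /above; case: (e _) => [[|[|[|?]]] ?].
have omegaE v v' : (e (v, v') == fomega) = above true e v v'.
  by rewrite eval; case: ifP => // _; case: ifP.
have oneE v v' : (e (v, v') == fone) = above false e v v' && ~~ above true e v v'.
  by rewrite eval; case: ifP => [/sub -> //|_]; case: ifP.
split=> v v'; rewrite {1}/above ffunE /=; case: ifP => [un|].
- by move: un => /andP[+ _]; rewrite oneE => /andP[-> _].
- by [].
- symmetry; move: un => /andP[_ /existsP[u /existsP[u' /and3P[]]]].
  rewrite !omegaE oneE => vu /andP[uu' _] uv'.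
  by apply/relmulP; exists u => //; apply/relmulP; exists u'.
- rewrite /unstable oneE => /negbT nun; rewrite -/(above true e v v').
  apply/idP/relmulP => [|[u vu /relmulP[u' uu' uv']]].
    move=> vv'; have [t [tt vt tv']] := relidem_interpolant i1 vv'.
    by exists t => //; apply/relmulP; exists t => //; apply: sub.
  apply/negPn/negP => nv; move: nun; rewrite nv andbT.
  have -> : above false e v v'.
    by apply: relidem_trans (sub _ _ vu) _ => //; apply: relidem_trans (sub _ _ uv').
  case/negP; apply/existsP; exists u; apply/existsP; exists u'.
  rewrite !omegaE vu uv' oneE uu' /= andbT; apply: contra nv => uu1.
  by apply: relidem_trans vu _ => //; apply: relidem_trans uv'.
Qed.

(** At threshold omega, transitivity shortens the products, and a vertex reflexive for
    [above true e] lengthens them again. At threshold 0 the operation changes nothing. *)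
Lemma flow_sharp_below e : e ** e = e ->
  [/\ flow_sharp e ** flow_sharp e = flow_sharp e,
      e ** flow_sharp e = flow_sharp e & flow_sharp e ** e = flow_sharp e].
Proof.
move=> ee; have i0 := above_idem false ee; have i1 := above_idem true ee.
have [s0 s1] := flow_sharpE ee.
have sub v v' : above true e v v' -> above false e v v'.
  by rewrite /above; lia.
have factor v v' : above true (flow_sharp e) v v' ->
    exists u u', [/\ above true e v u, above false e u u' & above true e u' v'].
  by rewrite s1 => /relmulP[u ? /relmulP[u' ? ?]]; exists u, u'.
have sharpI v u u' v' : above true e v u -> above false e u u' ->
    above true e u' v' -> above true (flow_sharp e) v v'.
  by move=> *; rewrite s1; apply/relmulP; exists u => //; apply/relmulP; exists u'.
split; apply: above_ext => -[] v v'; rewrite above_mul.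
- apply/relmulP/idP => [[w /factor[u [u' [vu uu' uw]]] /factor[t [t' [wt tt' tv]]]]|].
    apply: (sharpI _ u t') => //; apply: relidem_trans uu' _ => //.
    by apply: relidem_trans (sub _ _ uw) _ => //; apply: relidem_trans (sub _ _ wt) _.
  move=> /factor[u [u' [vu uu' uv]]].
  have [t [tt vt tu]] := relidem_interpolant i1 vu.
  exists t; last by apply: (sharpI _ u u').
  by apply: (sharpI _ t t) => //; apply: sub.
- by rewrite (eq_relmul s0 s0) i0 s0.
- apply/relmulP/idP => [[w vw /factor[u [u' [wu uu' uv]]]]|/factor[u [u' [vu uu' uv]]]].
    by apply: (sharpI _ u u') => //; apply: relidem_trans wu.
  have [t [tt vt tu]] := relidem_interpolant i1 vu.
  by exists t => //; apply: (sharpI _ u u').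
- by rewrite (eq_relmul (fun _ _ => erefl) s0) i0 s0.
- apply/relmulP/idP => [[w /factor[u [u' [vu uu' uw]]] wv]|/factor[u [u' [vu uu' uv]]]].
    by apply: (sharpI _ u u') => //; apply: relidem_trans wv.
  have [t [tt ut tv]] := relidem_interpolant i1 uv.
  by exists t => //; apply: (sharpI _ u u').
- by rewrite (eq_relmul s0 (fun _ _ => erefl)) i0 s0.
Qed.

(** * Rank classes and consecutive idempotents *)

Fixpoint flow_exp x n := if n is n'.+1 then x ** flow_exp x n' else flow_one.

Lemma flow_expD x m n : flow_exp x (m + n) = flow_exp x m ** flow_exp x n.
Proof. by elim: m => [|m IH]; rewrite ?flow_mul1 //= -flow_mulA -IH. Qed.

Lemma flow_expSr x n : flow_exp x n.+1 = flow_exp x n ** x.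
Proof. by rewrite -(addn1 n) flow_expD /= flow_mulr1. Qed.

Lemma flow_exp_idem x :
  exists n, flow_exp x n.+1 ** flow_exp x n.+1 = flow_exp x n.+1.
Proof.
have /injectivePn[i [j neq_ij eq_ij]] :
    ~~ injectiveb (fun i : 'I_#|flow V|.+1 => flow_exp x i).
  by apply/injectiveP => /leq_card; rewrite card_ord ltnn.
have {neq_ij eq_ij} [m [q eqmq]] : exists m q, flow_exp x (m + q.+1) = flow_exp x m.
  case: (ltngtP i j) => [ij|ji|/val_inj /eqP]; last by rewrite (negPf neq_ij).
    by exists i, (j - i).-1; rewrite eq_ij; congr flow_exp; lia.
  by exists j, (i - j).-1; rewrite -eq_ij; congr flow_exp; lia.
have period r : flow_exp x (m + r * q.+1) = flow_exp x m.
  elim: r => [|r IH]; first by rewrite addn0.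
  by rewrite mulSn addnA flow_expD eqmq -flow_expD.
(* The exponent is [m.+1 * q.+1], a multiple of the period that exceeds the preperiod [m]. *)
exists (m * q.+1 + q); rewrite -flow_expD.
rewrite (_ : (m * q.+1 + q).+1 = m.+1 * q.+1); last by lia.
have -> : m.+1 * q.+1 = m + (m.+1 * q.+1 - m) by nia.
have -> : m + (m.+1 * q.+1 - m) + (m + (m.+1 * q.+1 - m)) =
  m + m.+1 * q.+1 + (m.+1 * q.+1 - m) by nia.
by rewrite flow_expD period -flow_expD.
Qed.

(* [rank_lt k x]: x lies J-below an idempotent of rank less than k. *)
Definition rank_lt k x :=
  exists e a b, [/\ e ** e = e, x = a ** e ** b & flow_rank e < k].

Lemma rank_lt_factor k x a b : rank_lt k x -> rank_lt k (a ** x ** b).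
Proof.
move=> [e [c [d [ee -> le_k]]]]; exists e, (a ** c), (d ** b); split=> //.
by rewrite !flow_mulA.
Qed.

Lemma rank_lt_mull k x a : rank_lt k x -> rank_lt k (a ** x).
Proof. by move=> /(@rank_lt_factor _ _ a flow_one); rewrite flow_mulr1. Qed.

Lemma rank_lt_mulr k x b : rank_lt k x -> rank_lt k (x ** b).
Proof. by move=> /(@rank_lt_factor _ _ flow_one b); rewrite flow_mul1. Qed.

Lemma rank_lt_idem k e : e ** e = e -> rank_lt k e <-> flow_rank e < k.
Proof.
move=> ee; split=> [[f [a [b [ff eE]]]]|le_k].
  exact: leq_ltn_trans (flow_rank_factor ee ff eE).
by exists e, flow_one, flow_one; rewrite flow_mul1 flow_mulr1.
Qed.

Lemma rank_lt_top x : rank_lt (2 * #|V| ^ 2).+1 x.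
Proof.
exists flow_one, flow_one, x; rewrite !flow_mul1.
by split=> //; rewrite ltnS flow_rank_le.
Qed.

Lemma rank_lt0 x : ~ rank_lt 0 x.
Proof. by move=> [e [a [b []]]]. Qed.

(* x lies in the maximal subgroup of an idempotent of rank k, in which t is an
   inverse of x. *)
Definition group_elt k x :=
  exists e t, [/\ e ** e = e, flow_rank e = k, x ** e = x, e ** x = x &
                  e = x ** t /\ e = t ** x].

(** The idempotent power [e] of [s] also fixes [p], so its rank is at least [k]; as [e] factors
    through [f], both ranks are [k]. Hence [s ** e = s], and [flow_exp s n] is the inverse. *)
Lemma group_elt_fix k p s :
  p ** s = p -> ~ rank_lt k p -> rank_lt k.+1 s -> group_elt k s.
Proof.
move=> ps nlp [f [a [b [ff sE le_f]]]].
have [n] := flow_exp_idem s; set e := flow_exp s n.+1 => ee.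
have pe : p ** e = p.
  by rewrite /e; elim: (n.+1) => [|m IH]; rewrite ?flow_mulr1 //= flow_mulA ps.
have le_e : k <= flow_rank e.
  rewrite leqNgt; apply/negP => /(rank_lt_idem k ee) lt_e; apply: nlp.
  by rewrite -pe; apply: rank_lt_mull.
pose c := flow_exp s n ** a.
have eE : e = c ** f ** b by rewrite /e flow_expSr {2}sE !flow_mulA.
have le_ef := flow_rank_factor ee ff eE.
(* [h] is an idempotent that factors through [e] and lies below [f]; as its rank has not dropped, it
   equals [f]. *)
pose h := f ** b ** e ** c ** f.
have hE : h ** h = h.
  have -> : h ** h = f ** b ** e ** (c ** (f ** f) ** b) ** e ** c ** f.
    by rewrite /h !flow_mulA.
  by rewrite ff -eE -!(flow_mulA (f ** b)) ee ee /h !flow_mulA.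
have le_eh : flow_rank e <= flow_rank h.
  apply: (@flow_rank_factor _ _ c b) => //.
  have -> : c ** h ** b = (c ** f ** b) ** e ** (c ** f ** b) by rewrite /h !flow_mulA.
  by rewrite -eE !ee.
have hf : h = f.
  apply: flow_rank_eq_below => //; first by rewrite /h -!flow_mulA ff.
    by rewrite /h !flow_mulA ff.
  by move: le_f le_e le_eh; lia.
have se : s ** e = s.
  rewrite {2}sE -{1}hf /h; have -> : a ** (f ** b ** e ** c ** f) ** b =
    (a ** f ** b) ** (e ** (c ** f ** b)) by rewrite !flow_mulA.
  by rewrite -sE -eE ee.
exists e, (flow_exp s n); split=> //.
- by move: le_f le_e le_ef; lia.
- by rewrite -{2}se /e -flow_expSr.
- by rewrite /e -flow_expSr.
Qed.

(** [g ** e] is an idempotent below [e] without loss of rank, so it is [e], and [g] acts on [x] as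
    [e] does. *)
Lemma absorb_right e g x r : e ** e = e -> g ** g = g -> e ** x = x ->
  g = x ** r -> flow_rank e <= flow_rank g -> g ** x = x.
Proof.
move=> ee gg ex gE le_eg; have eg : e ** g = g by rewrite gE flow_mulA ex.
have gee : g ** e = e.
  apply: flow_rank_eq_below; rewrite ?flow_mulA ?eg -?flow_mulA ?ee ?eg //.
    by rewrite !flow_mulA -(flow_mulA g) eg gg.
  apply: leq_trans le_eg _.
  apply: (@flow_rank_factor _ _ flow_one g) => //.
    by rewrite !flow_mulA -(flow_mulA g) eg gg.
  by rewrite flow_mul1 -flow_mulA eg gg.
by rewrite -{1}ex flow_mulA gee ex.
Qed.

Lemma absorb_left e g x r : e ** e = e -> g ** g = g -> x ** e = x ->
  g = r ** x -> flow_rank e <= flow_rank g -> x ** g = x.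
Proof.
move=> ee gg xe gE le_eg; have ge : g ** e = g by rewrite gE -flow_mulA xe.
have idem : (e ** g) ** (e ** g) = e ** g.
  by rewrite flow_mulA -(flow_mulA e) ge -flow_mulA gg.
have eeg : e ** g = e.
  apply: flow_rank_eq_below => //; first by rewrite -flow_mulA ge.
    by rewrite flow_mulA ee.
  apply: leq_trans le_eg _; apply: (@flow_rank_factor _ _ g flow_one) => //.
  by rewrite flow_mulr1 flow_mulA ge gg.
by rewrite -{1}xe -flow_mulA eeg xe.
Qed.

(** Let [g] be the idempotent of the group of [d]. Cancelling [d] gives [g ** c = g], while [y]
    absorbs [g] and [c] ends in [y], so [c ** g = c]. *)
Lemma group_chunk_idem k d y c q r :
  group_elt k y -> group_elt k d -> d = q ** y -> c = r ** y -> d ** c = d ->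
  c ** c = c.
Proof.
move=> [e [_ [ee rke ye _ _]]] [g [t [gg rkg dg gd [_ gE]]]] dE cE dc.
have yg : y ** g = y.
  by apply: (@absorb_left e g y (t ** q)); rewrite ?rke ?rkg // -flow_mulA -dE.
have gc : g ** c = g by rewrite gE -flow_mulA dc.
have cg : c ** g = c by rewrite cE -flow_mulA yg.
by rewrite -{1}cg -flow_mulA gc.
Qed.

(** [c] fixes the common left factor [x] and [c'] fixes the common right factor [y], so [c ** c']
    equals both. *)
Lemma group_chunk_eq k x y c c' r r' q q' :
  group_elt k x -> group_elt k y -> c ** c = c -> c' ** c' = c' ->
  k <= flow_rank c -> k <= flow_rank c' ->
  c = x ** r -> c' = x ** r' -> c = q ** y -> c' = q' ** y -> c = c'.
Proof.
move=> [e [_ [ee rke _ ex _]]] [f [_ [ff rkf yf _ _]]] cc cc' kc kc' cx cx' cy cy'.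
have gx : c ** x = x by apply: (@absorb_right e c x r); rewrite ?rke.
have yg : y ** c' = y by apply: (@absorb_left f c' y q'); rewrite ?rkf.
transitivity (c ** c'); first by rewrite {2}cy -flow_mulA yg.
by rewrite {1}cx' flow_mulA gx.
Qed.

Definition flow_prod (z : seq (flow V)) := foldr (@flow_mul V) flow_one z.

Lemma flow_prod_cat (z z' : seq (flow V)) :
  flow_prod (z ++ z') = flow_prod z ** flow_prod z'.
Proof. by elim: z => [|x z IH] /=; rewrite ?flow_mul1 // IH flow_mulA. Qed.

Lemma rank_lt_prod k (z1 z z2 : seq (flow V)) :
  rank_lt k (flow_prod z) -> rank_lt k (flow_prod (z1 ++ z ++ z2)).
Proof. by rewrite !flow_prod_cat flow_mulA; apply: rank_lt_factor. Qed.

(** Three values per entry are rounded up to four, to get a power of two. *)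
Lemma card_flow : #|flow V| <= 2 ^ (2 * #|V| ^ 2).
Proof.
rewrite card_ffun card_ord card_prod mulnn expnM.
by case: (posnP (#|V| ^ 2)) => [->|n0] //; rewrite leq_exp2r.
Qed.

Lemma rank_lt_prod_mem k (z : seq (flow V)) :
  z != [::] -> {in z, forall x, rank_lt k x} -> rank_lt k (flow_prod z).
Proof.
case: z => // x z _ lt_z; apply: rank_lt_mulr; apply: lt_z; exact: mem_head.
Qed.

(* Between positions of z with the same prefix product every slice is a group
   element; three such positions that moreover have the same neighbouring
   slices and the same slice from the first position bound two slices that are
   equal and idempotent. *)
Lemma consecutive_idempotents k (z : seq (flow V)) :
  {in z, forall x, rank_lt k.+1 x} -> ~ rank_lt k (flow_prod z) ->
  2 ^ (8 * #|V| ^ 2 + 2) <= size z ->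
  exists (z1 z2 z3 z4 : seq (flow V)) c, [/\ z = z1 ++ z2 ++ z3 ++ z4,
    z2 != [::] /\ z3 != [::], flow_prod z2 = c, flow_prod z3 = c & c ** c = c].
Proof.
move=> lt_z nlt_z size_z; pose pr i j := flow_prod (slice i j z).
have prM i j l : i <= j -> j <= l -> pr i l = pr i j ** pr j l.
  by move=> ij jl; rewrite /pr (slice_cat z ij jl) flow_prod_cat.
have pr_lt i j : i < j -> j <= size z -> rank_lt k.+1 (pr i j).
  move=> ij jz; apply: rank_lt_prod_mem => [|x /mem_take/mem_drop/lt_z //].
  by rewrite slice_neq0.
have pr_nlt i j : i <= j -> j <= size z -> ~ rank_lt k (pr i j).
  move=> ij jz lt_ij; apply: nlt_z.
  rewrite -(cat_take_drop i z) -(cat_take_drop (j - i) (drop i z)).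
  exact: rank_lt_prod.
(* More than [K] positions share a prefix product. Without the first and the last, more than
   [2 * M ^ 3] remain, so three of them agree on the triple [data]. *)
set M := #|flow V|; set K := 2 * M ^ 3 + 2.
have leM : M * K < (size z).+1.
  rewrite ltnS; apply: leq_trans size_z.
  have := card_flow; rewrite -/M; set s := 2 * _ => leMs.
  rewrite (_ : 8 * _ + 2 = 2 + s * 4); last by rewrite /s; lia.
  rewrite expnD expnM; set X := 2 ^ s in leMs *.
  have X1 : 0 < X by rewrite expn_gt0.
  have : M ^ 3 <= X ^ 3 by rewrite leq_exp2r.
  have : 0 < X ^ 3 by rewrite expn_gt0 X1.
  by rewrite /K (expnS X 3) (_ : 2 ^ 2 = 4) //; nia.
have [p [I [sizeI sortI inI]]] := pigeonhole_positions (fun i => pr 0 i) 0 leM.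
pose pos t := nth 0 I t.
have posI t : t < size I -> pos t <= size z /\ pr 0 (pos t) = p.
  by move=> /(mem_nth 0)/inI[]; rewrite add0n ltnS.
have pos_lt t u : t < u -> u < size I -> pos t < pos u.
  move=> tu uI; apply: (sorted_ltn_nth ltn_trans 0 sortI) => //.
  by rewrite inE; apply: ltn_trans uI.
have pos_le t u : t <= u -> u < size I -> pos t <= pos u.
  by rewrite leq_eqVlt => /predU1P[-> //|tu] /(pos_lt _ _ tu)/ltnW.
have fix_p t u : t <= u -> u < size I -> p ** pr (pos t) (pos u) = p.
  move=> tu uI; have tI := leq_ltn_trans tu uI.
  rewrite -{1}(proj2 (posI t tI)) -prM ?pos_le //; exact: (proj2 (posI u uI)).
have nlt_p : ~ rank_lt k p.
  have I0 : 0 < size I by lia.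
  by have [le0 <-] := posI 0 I0; apply: pr_nlt.
have grp t u : t < u -> u < size I -> group_elt k (pr (pos t) (pos u)).
  move=> tu uI; apply: (group_elt_fix (fix_p t u (ltnW tu) uI)) => //.
  by apply: pr_lt; rewrite ?pos_lt //; case: (posI u uI).
pose data t := (pr (pos t.-1) (pos t), pr (pos t) (pos t.+1), pr (pos 0) (pos t)).
have le2 : #|{: flow V * flow V * flow V}| * 2 < size I - 2.
  by rewrite !card_prod -/M; move: sizeI; rewrite /K !expnS expn0; lia.
have [[[y x] d] [J [sizeJ sortJ inJ]]] := pigeonhole_positions data 1 le2.
pose j t := nth 0 J t.
have jJ t : t < 3 -> [/\ 0 < j t, (j t).+1 < size I & data (j t) = (y, x, d)].
  move=> t3; have /(mem_nth 0)/inJ[] : t < size J by apply: leq_trans sizeJ.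
  by rewrite -/(j t) => /andP[j0 jI] ->; split=> //; lia.
have jlt t : t < 2 -> j t < j t.+1.
  by move=> t2; apply: (sorted_ltn_nth ltn_trans 0 sortJ); rewrite ?inE //; lia.
have [j00 j0I [y0 x0 d0]] := jJ 0 isT.
have grpy : group_elt k y by rewrite -y0; apply: grp; lia.
have grpx : group_elt k x by rewrite -x0; apply: grp; lia.
have grpd : group_elt k d by rewrite -d0; apply: grp; lia.
have dE : d = pr (pos 0) (pos (j 0).-1) ** y.
  by rewrite -d0 -y0 -prM ?pos_le //; lia.
(* Such a slice begins with [x], ends with [y], and is fixed by [d] on its left because the slices
   from [pos 0] to its two ends agree. *)
pose c t := pr (pos (j t)) (pos (j t.+1)).
have cP t : t < 2 -> [/\ c t ** c t = c t, k <= flow_rank (c t),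
    exists r, c t = x ** r & exists r, c t = r ** y].
  move=> t2; have [jt0 jtI [yt xt dt]] := jJ t (ltnW t2).
  have [ju0 juI [yu xu du]] := jJ t.+1 t2; have ltj := jlt t t2.
  have cx : c t = x ** pr (pos (j t).+1) (pos (j t.+1)).
    by rewrite -xt -prM ?pos_le //; lia.
  have cy : c t = pr (pos (j t)) (pos (j t.+1).-1) ** y.
    by rewrite -yu -prM ?pos_le //; lia.
  have dc : d ** c t = d.
    by rewrite -{1}dt -prM ?du // ?pos_le //; lia.
  have cc := group_chunk_idem grpy grpd dE cy dc.
  split=> //; last 2 first; [by eexists; exact: cx | by eexists; exact: cy |].
  rewrite leqNgt; apply/negP => /(rank_lt_idem k cc); apply: pr_nlt.
    by apply: pos_le; lia.
  by have [] := posI (j t.+1) (ltnW juI).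
have [cc0 k0 [r0 cx0] [q0 cy0]] := cP 0 isT.
have [cc1 k1 [r1 cx1] [q1 cy1]] := cP 1 isT.
have eqc : c 0 = c 1 := group_chunk_eq grpx grpy cc0 cc1 k0 k1 cx0 cx1 cy0 cy1.
have [_ j1I _] := jJ 1 isT; have [_ j2I _] := jJ 2 isT.
have p01 : pos (j 0) < pos (j 1) by apply: pos_lt; [exact: jlt | lia].
have p12 : pos (j 1) < pos (j 2) by apply: pos_lt; [exact: jlt | lia].
have p2z : pos (j 2) <= size z by case: (posI (j 2) (ltnW j2I)).
exists (take (pos (j 0)) z), (slice (pos (j 0)) (pos (j 1)) z),
  (slice (pos (j 1)) (pos (j 2)) z), (drop (pos (j 2)) z), (c 0); split=> //.
- rewrite -{1}(cat_take_drop (pos (j 2)) z) !catA; congr cat.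
  have tE i : take i z = slice 0 i z by rewrite /slice subn0 drop0.
  by rewrite !tE -(slice_cat z (leq0n _) (ltnW p01)) -(slice_cat z (leq0n _) (ltnW p12)).
- by split; apply: slice_neq0 => //; apply: leq_trans (ltnW p12) p2z.
Qed.

(** * Summaries and segmentations *)

Section Summaries.

Variable A : {fset constraint V}.

Implicit Types (u v w : seq (flow V)) (ws : seq (seq (flow V))).

Definition summarizable h x u :=
  exists t, [/\ sharp_summary A t, label t = (x, u) & height t <= h].

Lemma summarizable_leq h h' x u :
  h <= h' -> summarizable h x u -> summarizable h' x u.
Proof. by move=> hh' [t [St lt ht]]; exists t; split=> //; apply: leq_trans hh'. Qed.

Lemma summarizable_mul h x y u v :
  summarizable h x u -> summarizable h y v -> summarizable h.+1 (x ** y) (u ++ v).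
Proof.
move=> [t [St lt ht]] [t' [St' lt' ht']].
exists (Node (x ** y, u ++ v) t t'); split=> //; first exact: SumProd lt St' lt'.
by rewrite /= ltnS geq_max ht ht'.
Qed.

Lemma summarizable_sharp h e u1 ws u2 :
  e ** e = e -> summarizable h e u1 -> summarizable h e u2 ->
  {in ws, forall w, exists h', summarizable h' e w} ->
  summarizable h.+1 (flow_sharp e) (u1 ++ flatten ws ++ u2).
Proof.
move=> ee [t [St lt ht]] [t' [St' lt' ht']] sws.
exists (Node (flow_sharp e, u1 ++ flatten ws ++ u2) t t'); split=> //.
  apply: SumIdem St lt St' lt' _; first by rewrite /flow_idempotent ee.
  by move=> w /sws[h' [t'' [? ? _]]]; exists t''.
by rewrite /= ltnS geq_max ht ht'.
Qed.

Local Notation item := (flow V * seq (flow V))%type.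

Definition items_val (W : seq item) := flow_prod (map fst W).
Definition items_word (W : seq item) := flatten (map snd W).

Lemma items_val_cat W W' : items_val (W ++ W') = items_val W ** items_val W'.
Proof. by rewrite /items_val map_cat flow_prod_cat. Qed.

Lemma items_word_cat W W' : items_word (W ++ W') = items_word W ++ items_word W'.
Proof. by rewrite /items_word map_cat flatten_cat. Qed.

(** Halving gives a balanced tree of product nodes, [k] levels above the items. *)
Lemma summarizable_items h k (W : seq item) :
  W != [::] -> {in W, forall p, summarizable h p.1 p.2} -> size W <= 2 ^ k ->
  summarizable (h + k) (items_val W) (items_word W).
Proof.
elim: k W => [|k IH] W.
  case: W => [|p [|//]] // _ sW _; rewrite addn0 /items_val /items_word /=.
  by rewrite flow_mulr1 cats0; apply: sW; rewrite mem_head.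
move=> W0 sW; case: (leqP (size W) (2 ^ k)) => [leW _|ltW leW].
  by apply: summarizable_leq (IH _ W0 sW leW); rewrite leq_add2l.
have k0 : 0 < 2 ^ k by rewrite expn_gt0.
rewrite -(cat_take_drop (2 ^ k) W) items_val_cat items_word_cat addnS.
apply: summarizable_mul; apply: IH.
- by rewrite -size_eq0 size_takel -?lt0n // ltnW.
- by move=> p /mem_take/sW.
- by rewrite size_takel // ltnW.
- by rewrite -size_eq0 size_drop -lt0n subn_gt0.
- by move=> p /mem_drop/sW.
- by rewrite size_drop leq_subLR addnn -mul2n -expnS.
Qed.

(** This serves for the middle factors of idempotent nodes, whose heights are free. *)
Lemma summarizable_items_any (W : seq item) :
  W != [::] -> {in W, forall p, exists h, summarizable h p.1 p.2} ->
  exists h, summarizable h (items_val W) (items_word W).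
Proof.
case: W => // p W _; elim: W p => [|q W IH] p sW.
  rewrite /items_val /items_word /= flow_mulr1 cats0.
  by apply: sW; rewrite mem_head.
have [|h1 s1] := IH q; first by move=> r rW; apply: sW; rewrite inE rW orbT.
have [h0 s0] := sW p (mem_head _ _).
exists (maxn h0 h1).+1; rewrite -[p :: _]/([:: p] ++ (q :: W)).
rewrite items_val_cat items_word_cat; apply: summarizable_mul.
  rewrite /items_val /items_word /= flow_mulr1 cats0.
  by apply: summarizable_leq s0; rewrite leq_maxl.
by apply: summarizable_leq s1; rewrite leq_maxr.
Qed.

(* A segment is either an item left as it is, [(None, [:: p])], or a block of
   items to be replaced by a single idempotent node, [(Some e, W)]. *)
Local Notation segment := (option (flow V) * seq item)%type.

Definition seg_val (q : segment) :=
  if q.1 is Some e then flow_sharp e else items_val q.2.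

Definition segs_val (S : seq segment) := flow_prod (map seg_val S).

Definition segs_items (S : seq segment) := flatten (map snd S).

Lemma segs_val_cat S S' : segs_val (S ++ S') = segs_val S ** segs_val S'.
Proof. by rewrite /segs_val map_cat flow_prod_cat. Qed.

Lemma segs_items_cat S S' : segs_items (S ++ S') = segs_items S ++ segs_items S'.
Proof. by rewrite /segs_items map_cat flatten_cat. Qed.

Lemma segs_val_flatten L : segs_val (flatten L) = flow_prod (map segs_val L).
Proof. by elim: L => //= S L IH; rewrite segs_val_cat IH. Qed.

Lemma segs_items_word S :
  items_word (segs_items S) = flatten [seq items_word q.2 | q <- S].
Proof. by elim: S => //= q S IH; rewrite [segs_items _]/= items_word_cat IH. Qed.

Definition idem_node h e w := exists u1 ws u2, [/\ w = u1 ++ flatten ws ++ u2,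
  summarizable h e u1, summarizable h e u2 &
  {in ws, forall v, exists h', summarizable h' e v}].

Definition seg_ok h k (q : segment) :=
  if q.1 is Some e then
    [/\ e ** e = e, flow_rank e = k & idem_node h e (items_word q.2)]
  else exists p, q.2 = [:: p].

Definition segmentation h k (W : seq item) (S : seq segment) :=
  segs_items S = W /\ {in S, forall q, seg_ok h k q}.

(** Only the items are kept: the value may change, since a block counts as [flow_sharp e]. *)
Lemma segmentation_replace h k W S1 S2 S3 q :
  segmentation h k W (S1 ++ S2 ++ S3) -> segs_items S2 = q.2 -> seg_ok h k q ->
  segmentation h k W (S1 ++ q :: S3).
Proof.
move=> [<- okS] qE okq; split=> [|r].
  by rewrite -cat1s !segs_items_cat qE /segs_items /= cats0.
rewrite mem_cat inE => /or3P[rS|/eqP-> //|rS]; apply: okS.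
  by rewrite mem_cat rS.
by rewrite !mem_cat rS !orbT.
Qed.

Lemma seg_summarizable h k W S q :
  segmentation h k W S -> {in W, forall p, summarizable h p.1 p.2} -> q \in S ->
  summarizable h.+1 (seg_val q) (items_word q.2).
Proof.
move=> [WE okS] sW qS; have := okS q qS.
have qW p : p \in q.2 -> p \in W.
  by move=> pq; rewrite -WE; apply/flattenP; exists q.2 => //; apply: map_f.
rewrite /seg_val /seg_ok; case: q qS qW => -[e|] b /= qS qW.
  by move=> [ee _ [u1 [ws [u2 [-> s1 s2 sws]]]]]; apply: summarizable_sharp.
move=> [p bE]; move: qW; rewrite bE => /(_ p (mem_head _ _))/sW sp.
rewrite /items_val /items_word /= flow_mulr1 cats0.
exact: summarizable_leq sp.
Qed.

Lemma unmarked_segs h k S :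
  {in S, forall q, seg_ok h k q} -> all (predC isSome) (map fst S) ->
  size (segs_items S) = size S /\ items_val (segs_items S) = segs_val S.
Proof.
elim: S => [|[[e|] b] S IH] //= okS aS.
have [p /= bE] := okS _ (mem_head _ _).
have [|sS vS] := IH _ aS; first by move=> q qS; apply: okS; rewrite inE qS orbT.
rewrite -cat1s segs_items_cat segs_val_cat items_val_cat -vS size_cat sS.
by rewrite /segs_items /segs_val /seg_val /= cats0 flow_mulr1 bE.
Qed.

(** * Shortening a segmentation *)

Lemma segs_nlt k X Y Z :
  ~ rank_lt k (segs_val (X ++ Y ++ Z)) -> ~ rank_lt k (segs_val Y).
Proof.
move=> nlt /(@rank_lt_factor _ _ (segs_val X) (segs_val Z)).
by rewrite -flow_mulA -!segs_val_cat.
Qed.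

Lemma segs_items_mem h k W X Y Z p :
  segmentation h k W (X ++ Y ++ Z) -> p \in segs_items Y -> p \in W.
Proof. by move=> [<- _] pY; rewrite !segs_items_cat !mem_cat pY orbT. Qed.

(** Cut [Y] into [2 ^ m] chunks of [2 ^ r] items, each of value [rank_lt k.+1]. Two consecutive
    groups of chunks have the same idempotent value and merge into one block; each has at most
    [2 ^ (r + m)] items, whence the height [h + (r + m)]. *)
Lemma collapse_unmarked h r k W X Y Z (m := 8 * #|V| ^ 2 + 2) :
  {in W, forall p, summarizable h p.1 p.2} ->
  (forall W1 W2 W3, W = W1 ++ W2 ++ W3 -> 2 ^ r <= size W2 ->
     rank_lt k.+1 (items_val W2)) ->
  segmentation (h + (r + m)) k W (X ++ Y ++ Z) ->
  size Y = 2 ^ m * 2 ^ r -> all (predC isSome) (map fst Y) ->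
  ~ rank_lt k (segs_val Y) ->
  exists S, segmentation (h + (r + m)) k W S /\ size S < size (X ++ Y ++ Z).
Proof.
move=> sW lt_W segS sizeY noneY nltY.
have okY : {in Y, forall q, seg_ok (h + (r + m)) k q}.
  by move=> q qY; apply: (proj2 segS); rewrite !mem_cat qY orbT.
have subY Y1 Y2 Y3 : Y = Y1 ++ Y2 ++ Y3 -> [/\ size (segs_items Y2) = size Y2,
    items_val (segs_items Y2) = segs_val Y2 &
    segmentation (h + (r + m)) k W ((X ++ Y1) ++ Y2 ++ (Y3 ++ Z))].
  move=> YE; have [||sz vl] := @unmarked_segs (h + (r + m)) k Y2.
  - by move=> q qY; apply: okY; rewrite YE !mem_cat qY orbT.
  - by move: noneY; rewrite YE !map_cat !all_cat => /and3P[].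
  by split=> //; move: segS; rewrite YE -!catA.
pose L := reshape (nseq (2 ^ m) (2 ^ r)) Y.
have sumE : sumn (nseq (2 ^ m) (2 ^ r)) = size Y by rewrite sumn_nseq mulnC sizeY.
have LE : flatten L = Y by rewrite reshapeKr // sumE.
have shL : shape L = nseq (2 ^ m) (2 ^ r) by rewrite reshapeKl // sumE.
have sizeL l : l \in L -> size l = 2 ^ r.
  by move=> /(map_f size); rewrite -/(shape L) shL => /nseqP[].
have [||| z1 [z2 [z3 [z4 [c [zE [z2n z3n] z2c z3c cc]]]]]] :=
    @consecutive_idempotents k (map segs_val L).
- move=> _ /mapP[l lL ->]; move: (lL) (LE) => /splitPr[L1 L2].
  rewrite flatten_cat /= => YE; have [sz <- segl] := subY _ _ _ (esym YE).
  apply: (lt_W (segs_items (X ++ flatten L1)) _ (segs_items (flatten L2 ++ Z))).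
    by rewrite -!segs_items_cat; case: segl.
  by rewrite sz sizeL.
- by rewrite -segs_val_flatten LE.
- by rewrite size_map -(size_map size L) -/(shape L) shL size_nseq.
have [L1 [L' [LE1 _ /map_eq_cat[L2 [L'' [L'E v2 /map_eq_cat[L3 [L4 [L''E v3 _]]]]]]]]] :=
  map_eq_cat zE.
rewrite {}L'E {}L''E in LE1.
have YE : Y = flatten L1 ++ (flatten L2 ++ flatten L3) ++ flatten L4.
  by rewrite -LE LE1 !flatten_cat !catA.
have mem_L l : (l \in L2) || (l \in L3) -> size l = 2 ^ r.
  by move=> lL; apply: sizeL; rewrite LE1 !mem_cat; case/orP: lL => ->; rewrite !orbT.
have r0 : 0 < 2 ^ r by rewrite expn_gt0.
have flat0 (L0 : seq (seq segment)) : L0 != [::] -> {in L0, forall l, size l = 2 ^ r} ->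
    2 ^ r <= size (flatten L0).
  by case: L0 => // l L0 _ /(_ l (mem_head _ _)) sl; rewrite size_cat sl leq_addr.
have L2n : 2 ^ r <= size (flatten L2).
  apply: flat0 => [|l lL]; last by apply: mem_L; rewrite lL.
  by apply: contra z2n => /eqP L20; rewrite -v2 L20.
have L3n : 2 ^ r <= size (flatten L3).
  apply: flat0 => [|l lL]; last by apply: mem_L; rewrite lL orbT.
  by apply: contra z3n => /eqP L30; rewrite -v3 L30.
have [_ vY segY] := subY _ _ _ YE.
have sizeYE := congr1 size YE; rewrite !size_cat in sizeYE.
have part Y1 Y2 Y3 : Y = Y1 ++ Y2 ++ Y3 -> 0 < size Y2 -> segs_val Y2 = c ->
    summarizable (h + (r + m)) c (items_word (segs_items Y2)).
  move=> YE' Y20 vc; have [sz vl seg2] := subY _ _ _ YE'.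
  rewrite -vc -vl; apply: summarizable_items.
  - by rewrite -size_eq0 sz -lt0n.
  - by move=> p pY; apply: sW; apply: segs_items_mem seg2 pY.
  - rewrite sz addnC expnD -sizeY YE' !size_cat; lia.
have nlt_c : ~ rank_lt k c.
  rewrite -z2c -v2 -segs_val_flatten.
  apply: (@segs_nlt _ (flatten L1) _ (flatten L3 ++ flatten L4)).
  by move: nltY; rewrite {1}YE -!catA.
exists ((X ++ flatten L1) ++
  (Some c, segs_items (flatten L2 ++ flatten L3)) :: (flatten L4 ++ Z)); split; last first.
  by rewrite !size_cat /= !size_cat sizeYE; lia.
apply: (segmentation_replace segY) => //=; split=> //.
  (* The rank of [c] is exactly [k]: no drop occurs inside [Y], and [c] has a factor of at least
     [2 ^ r] items. *)
  apply/eqP; rewrite eqn_leq; apply/andP; split; last first.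
    by rewrite leqNgt; apply/negP => /(rank_lt_idem k cc).
  rewrite -ltnS; apply/(rank_lt_idem k.+1 cc).
  have YE2 : Y = flatten L1 ++ flatten L2 ++ (flatten L3 ++ flatten L4).
    by rewrite YE !catA.
  have [sz vl seg2] := subY _ _ _ YE2.
  rewrite -z2c -v2 -segs_val_flatten -vl.
  apply: (lt_W (segs_items (X ++ flatten L1)) _
    (segs_items ((flatten L3 ++ flatten L4) ++ Z))); last by rewrite sz.
  by rewrite -!segs_items_cat; case: seg2.
exists (items_word (segs_items (flatten L2))), [::],
  (items_word (segs_items (flatten L3))); split=> //=.
- by rewrite segs_items_cat items_word_cat.
- apply: (part (flatten L1) _ (flatten L3 ++ flatten L4)) => //.
  - by rewrite YE !catA.
  - exact: leq_trans L2n.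
  by rewrite segs_val_flatten v2.
- apply: (part (flatten L1 ++ flatten L2) _ (flatten L4)) => //.
  - by rewrite YE !catA.
  - exact: leq_trans L3n.
  by rewrite segs_val_flatten v3.
Qed.

(** The new node keeps the first child of [q0] and the last child of [q1], so its height bound is
    unchanged. All that lies between becomes middle factors. *)
Lemma idem_node_merge h k W X q0 Y q1 Z e :
  segmentation h k W (X ++ (q0 :: Y ++ [:: q1]) ++ Z) ->
  {in W, forall p, summarizable h p.1 p.2} ->
  e ** e = e -> q0.1 = Some e -> q1.1 = Some e -> e ** segs_val Y ** e = e ->
  idem_node h e (items_word (segs_items (q0 :: Y ++ [:: q1]))).
Proof.
move=> segS sW ee q0e q1e eYe; have [_ okS] := segS.
have ok q : q.1 = Some e -> q \in q0 :: Y ++ [:: q1] -> idem_node h e (items_word q.2).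
  move=> qe qS; have := okS q; rewrite !(mem_cat, qS) orbT => /(_ isT).
  by rewrite /seg_ok qe => -[].
have [|u1 [ws [u2 [w0 s1 s2 sws]]]] := ok q0 q0e; first by rewrite mem_head.
have [|u1' [ws' [u2' [w1 s1' s2' sws']]]] := ok q1 q1e.
  by rewrite inE mem_cat mem_head !orbT.
(* The second child of [q0], the segments of [Y] and the first child of [q1] form a single middle
   factor, of value [e ** segs_val Y ** e = e]. *)
pose mid : seq item :=
  (e, u2) :: [seq (seg_val q, items_word q.2) | q <- Y] ++ [:: (e, u1')].
have [//|p|h' s'] := @summarizable_items_any mid.
  rewrite inE mem_cat inE => /or3P[/eqP->|/mapP[q qY ->]|/eqP->] /=;
    [by exists h| |by exists h].
  exists h.+1; apply: (seg_summarizable segS) => //.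
  by rewrite !(mem_cat, inE) qY !orbT.
have midv : items_val mid = e.
  rewrite /mid -cat1s !items_val_cat /items_val /= !flow_mulr1 -map_comp.
  by rewrite flow_mulA -[RHS]eYe.
have midw : items_word mid = u2 ++ items_word (segs_items Y) ++ u1'.
  rewrite /mid -cat1s !items_word_cat segs_items_word /items_word /= !cats0.
  by rewrite -map_comp.
exists u1, (ws ++ items_word mid :: ws'), u2'; split=> //.
  rewrite -cat1s !segs_items_cat !items_word_cat midw flatten_cat /=.
  by rewrite !segs_items_word /= !cats0 w0 w1 -!catA.
move=> v; rewrite mem_cat inE => /or3P[/sws //|/eqP->|/sws' //].
by exists h'; rewrite -{1}midv.
Qed.

(** Some [e] marks at least [2 ^ m] segments. Cutting before each of them gives pieces with values
    in [e ** _], among which consecutive idempotents are found; two marks [e] are then merged with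
    everything between them. *)
Lemma collapse_marked h k W X Y Z (m := 8 * #|V| ^ 2 + 2) :
  {in W, forall p, summarizable h p.1 p.2} ->
  segmentation h k W (X ++ Y ++ Z) ->
  2 ^ (2 * #|V| ^ 2) * 2 ^ m < count (fun q => isSome q.1) Y ->
  ~ rank_lt k (segs_val Y) ->
  exists S, segmentation h k W S /\ size S < size (X ++ Y ++ Z).
Proof.
move=> sW segS cntY nltY.
have [e cnt_e] : exists e, 2 ^ m < count_mem e (pmap fst Y).
  apply: pigeonhole_mem; rewrite size_pmap; apply: leq_ltn_trans cntY.
  by rewrite leq_mul2r card_flow orbT.
have {cnt_e} : 2 ^ m <= count (fun q => q.1 == Some e) Y.
  apply: leq_trans (ltnW cnt_e) _; rewrite leq_eqVlt; apply/orP; left; apply/eqP.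
  by elim: (Y) => [|[[f|] b] Y' IH] //=; rewrite IH.
move=> /cut_before[Y0 [L [YE sizeL headL]]].
have headP l : l \in L -> exists q l', l = q :: l' /\ q.1 = Some e.
  by move=> lL; have := allP headL _ lL; case: l {lL} => // q l' /eqP; exists q, l'.
have nlt_factor S1 S2 S3 : Y = S1 ++ S2 ++ S3 -> ~ rank_lt k (segs_val S2).
  by move=> SE; apply: (@segs_nlt _ S1 _ S3); rewrite -SE.
have okY q : q \in Y -> seg_ok h k q.
  by move=> qY; apply: (proj2 segS); rewrite !mem_cat qY orbT.
have m0 : 0 < 2 ^ m by rewrite expn_gt0.
have [ee rke] : e ** e = e /\ flow_rank e = k.
  have lL := mem_nth [::] (leq_trans m0 (eq_leq (esym sizeL))).
  have [q [l' [lE qe]]] := headP _ lL.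
  have : q \in Y.
    rewrite YE mem_cat; apply/orP; right; apply/flattenP.
    by exists (nth [::] L 0) => //; rewrite lE mem_head.
  by move=> /okY; rewrite /seg_ok qe => -[].
have [shsh esh she] := flow_sharp_below ee.
(* Otherwise [flow_sharp e] has smaller rank, and it occurs as a factor of the value of [Y]. *)
have sharp_e : flow_sharp e = e.
  apply: flow_rank_eq_below => //; rewrite rke leqNgt.
  apply/negP => /(rank_lt_idem k shsh).
  have lL := mem_nth [::] (leq_trans m0 (eq_leq (esym sizeL))).
  have [q [l' [lE qe]]] := headP _ lL.
  move: lL YE => /splitPr[L1 L2]; rewrite flatten_cat /= lE => YE.
  have -> : flow_sharp e = segs_val [:: q].
    by rewrite /segs_val /seg_val /= qe flow_mulr1.
  apply: (nlt_factor (Y0 ++ flatten L1) _ (l' ++ flatten L2)).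
  by rewrite YE -!catA.
have valq q l : q.1 = Some e -> segs_val (q :: l) = e ** segs_val l.
  by move=> qe; rewrite {1}/segs_val /= {1}/seg_val qe sharp_e.
have [||| z1 [z2 [z3 [z4 [c [zE [z2n z3n] z2c _ cc]]]]]] :=
    @consecutive_idempotents k (map segs_val L).
- move=> _ /mapP[l /headP[q [l' [-> qe]]] ->]; rewrite valq //.
  by apply: rank_lt_mulr; apply/(rank_lt_idem _ ee); rewrite rke.
- by rewrite -segs_val_flatten; apply: (nlt_factor Y0 _ [::]); rewrite cats0.
- by rewrite size_map sizeL.
have [L1 [L' [LE _ /map_eq_cat[L2 [L'' [L'E v2 /map_eq_cat[L3 [L4 [L''E v3 _]]]]]]]]] :=
  map_eq_cat zE.
rewrite {}L'E {}L''E in LE.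
case: L2 => [|l2 L2] in LE v2 *; first by rewrite -v2 in z2n.
case: L3 => [|l3 L3] in LE v3 *; first by rewrite -v3 in z3n.
have [|q2 [l2' [l2E q2e]]] := headP l2; first by rewrite LE !(mem_cat, inE) eqxx !orbT.
have [|q3 [l3' [l3E q3e]]] := headP l3; first by rewrite LE !(mem_cat, inE) eqxx !orbT.
pose mid := l2' ++ flatten L2.
have cE : c = e ** segs_val mid.
  by rewrite -z2c -v2 -segs_val_flatten /= l2E cat_cons valq.
have YE' : Y = (Y0 ++ flatten L1) ++ (q2 :: mid ++ [:: q3]) ++
    (l3' ++ flatten L3 ++ flatten L4).
  by rewrite YE LE !flatten_cat /= l2E l3E /mid /= -?catA /= -?catA /= -?catA /= -?catA.
have ec : e ** c = c by rewrite cE flow_mulA ee.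
(* [c ** e] is an idempotent below [e], and its rank cannot drop because it is the value of a factor
   of [Y], ending at the mark [q3]. *)
have ce : c ** e = e.
  have idem : (c ** e) ** (c ** e) = c ** e.
    by rewrite flow_mulA -(flow_mulA c) ec cc.
  apply: flow_rank_eq_below => //; first by rewrite -flow_mulA ee.
    by rewrite flow_mulA ec.
  rewrite rke leqNgt; apply/negP => /(rank_lt_idem k idem).
  have -> : c ** e = segs_val (q2 :: mid ++ [:: q3]).
    by rewrite valq // segs_val_cat flow_mulA -cE valq // /segs_val /= flow_mulr1.
  exact: nlt_factor YE'.
have segS' : segmentation h k W ((X ++ Y0 ++ flatten L1) ++ (q2 :: mid ++ [:: q3]) ++
    ((l3' ++ flatten L3 ++ flatten L4) ++ Z)).
  by move: segS; rewrite {1}YE' -!catA.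
exists ((X ++ Y0 ++ flatten L1) ++ (Some e, segs_items (q2 :: mid ++ [:: q3])) ::
    ((l3' ++ flatten L3 ++ flatten L4) ++ Z)); split; last first.
  by rewrite YE' !size_cat /= !size_cat /=; lia.
apply: (segmentation_replace segS') => //=; split=> //.
by apply: (idem_node_merge segS') => //; rewrite -cE.
Qed.

Lemma collapse_step h r k W S
    (m := 8 * #|V| ^ 2 + 2) (D := 18 * #|V| ^ 2 + 6) :
  {in W, forall p, summarizable h p.1 p.2} ->
  (forall W1 W2 W3, W = W1 ++ W2 ++ W3 -> 2 ^ r <= size W2 ->
     rank_lt k.+1 (items_val W2)) ->
  segmentation (h + (r + m)) k W S ->
  (forall S1 S2 S3, S = S1 ++ S2 ++ S3 -> 2 ^ (r + D) <= size S2 ->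
     rank_lt k (segs_val S2)) \/
  (exists S', segmentation (h + (r + m)) k W S' /\ size S' < size S).
Proof.
move=> sW lt_W segS.
have [reducible|irreducible] :=
    classic (exists S', segmentation (h + (r + m)) k W S' /\ size S' < size S).
  by right.
left=> S1 S2 S3 SE size2; apply: NNPP => nlt; apply: irreducible.
have [[Y1 [Y2 [Y3 [S2E sizeY noneY]]]]|le_count] :=
    run_or_count (fun q : segment => isSome q.1) (2 ^ m * 2 ^ r) S2.
  have YE : S = (S1 ++ Y1) ++ Y2 ++ (Y3 ++ S3) by rewrite SE S2E -!catA.
  rewrite YE in segS *; apply: collapse_unmarked segS _ _ _ => //.
    by rewrite all_map.
  by apply: (@segs_nlt _ Y1 _ Y3); rewrite -S2E.
rewrite SE in segS *; apply: collapse_marked segS _ _ => //.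
  by move=> p /sW; apply: summarizable_leq; apply: leq_addr.
rewrite ltnNge; apply/negP => le2; move: size2; apply/negP; rewrite -ltnNge.
apply: leq_ltn_trans le_count _; rewrite -/m in le2.
(* With [N = 2 ^ (2 * #|V| ^ 2 + m)] bounding the number of marks, the length is at most
   [2 ^ (m + r) * (N + 1)], less than [2 ^ (m + r) * (4 * N)]. The factor 4 is the last summand
   2. *)
have -> : r + D = m + r + (2 * #|V| ^ 2 + m + 2) by rewrite /m /D; lia.
rewrite (expnD _ (m + r)) expnD ltn_pmul2l ?muln_gt0 ?expn_gt0 //.
rewrite (expnD _ (_ + m)) expnD; move: le2.
have : 0 < 2 ^ (2 * #|V| ^ 2) * 2 ^ m by rewrite muln_gt0 !expn_gt0.
by rewrite (_ : 2 ^ 2 = 4) //; lia.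
Qed.

(** Start with every item as its own segment and shorten as long as possible. *)
Lemma collapse_exists h r k W
    (m := 8 * #|V| ^ 2 + 2) (D := 18 * #|V| ^ 2 + 6) :
  {in W, forall p, summarizable h p.1 p.2} ->
  (forall W1 W2 W3, W = W1 ++ W2 ++ W3 -> 2 ^ r <= size W2 ->
     rank_lt k.+1 (items_val W2)) ->
  exists S, segmentation (h + (r + m)) k W S /\
    forall S1 S2 S3, S = S1 ++ S2 ++ S3 -> 2 ^ (r + D) <= size S2 ->
     rank_lt k (segs_val S2).
Proof.
move=> sW lt_W.
have [S segS] : exists S, segmentation (h + (r + m)) k W S.
  exists [seq (None, [:: p]) | p <- W]; split=> [|_ /mapP[p _ ->]]; last by exists p.
  by rewrite /segs_items -map_comp; elim: (W) => //= p W' ->.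
have [n] := ubnP (size S); elim: n S segS => // n IH S segS lt_S.
have [lt|[S' [segS' lt']]] := collapse_step sW lt_W segS; first by exists S.
by apply: (IH S') => //; apply: leq_trans lt' _.
Qed.

(** * Descent through the ranks and the height bound *)

Lemma stage t w (D := 18 * #|V| ^ 2 + 6) :
  flow_word A w -> t <= (2 * #|V| ^ 2).+1 ->
  exists W, [/\ items_word W = w,
    {in W, forall p, summarizable (t * t * D) p.1 p.2} &
    forall W1 W2 W3, W = W1 ++ W2 ++ W3 -> 2 ^ (t * D) <= size W2 ->
      rank_lt ((2 * #|V| ^ 2).+1 - t) (items_val W2)].
Proof.
move=> wA; elim: t => [_|t IH lt_t].
  exists [seq (x, [:: x]) | x <- w]; split=> [|_ /mapP[x xw ->]|? ? ? _ _].
  - by rewrite /items_word -map_comp; elim: (w) => //= x w' ->.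
  - by exists (Leaf (x, [:: x])); split=> //; apply: SumLeaf; apply: wA.
  - by rewrite subn0; apply: rank_lt_top.
have [W [Ww sW lt_W]] := IH (ltnW lt_t).
rewrite subSn in lt_W => //; rewrite subSS.
have [S [segS lt_S]] := collapse_exists sW lt_W.
exists [seq (seg_val q, items_word q.2) | q <- S]; split.
- rewrite -Ww -(proj1 segS) segs_items_word /items_word.
  by rewrite -map_comp.
- move=> _ /mapP[q qS ->] /=.
  have sW' : {in W, forall p,
      summarizable (t * t * D + (t * D + (8 * #|V| ^ 2 + 2))) p.1 p.2}.
    by move=> p /sW; apply: summarizable_leq; apply: leq_addr.
  apply: summarizable_leq (seg_summarizable segS sW' qS).
  (* A stage adds [t * D + (8 * #|V| ^ 2 + 2) + 1] to the height, which is at most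
     [(2 * t + 1) * D], the difference of consecutive squares times [D]. *)
  by rewrite /D; nia.
- move=> W1 W2 W3 /map_eq_cat[S1 [S' [SE _ /map_eq_cat[S2 [S3 [S'E <- _]]]]]].
  rewrite S'E in SE; rewrite size_map => le2.
  have -> : items_val [seq (seg_val q, items_word q.2) | q <- S2] = segs_val S2.
    by rewrite /items_val -map_comp.
  by apply: (lt_S S1 S2 S3) => //; rewrite addnC -mulSn.
Qed.

(** After [T] stages a factor of [2 ^ (T * D)] items would have a value below an idempotent of
    negative rank. So fewer items remain, and a balanced product of height [T * D] finishes. *)
Lemma summarizable_word w (T := (2 * #|V| ^ 2).+1) (D := 18 * #|V| ^ 2 + 6) :
  flow_word A w -> w <> [::] ->
  exists x, summarizable (T * T * D + T * D) x w.
Proof.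
move=> wA w0; have [W [Ww sW lt_W]] := stage wA (leqnn T).
exists (items_val W); rewrite -Ww; apply: summarizable_items => //.
  by apply/eqP => W0; apply: w0; rewrite -Ww W0.
rewrite leqNgt; apply/negP => /ltnW ltW.
have := lt_W [::] W [::]; rewrite cats0 subnn => /(_ erefl ltW).
exact: rank_lt0.
Qed.

End Summaries.

End FlowMonoid.

Theorem theorem33 (V : finType) (vs vt : V) (hst : vs <> vt)
    (A : {fset constraint V})
    (hA : forall a, a \in A -> capacity_constraint vs vt a)
    (w : seq (flow V)) (hw : flow_word A w) (hw0 : w <> [::]) :
  exists (t : btree (flow V * seq (flow V))) (x : flow V),
    [/\ sharp_summary A t,
        flow_semigroup A x,
        label t = (x, w) &
        (height t <= 536 * #|V| ^ 12)%N].
Proof.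
have [x [t [St lt ht]]] := summarizable_word hw hw0.
exists t, x; split=> //; first by have [] := sharp_summary_label St; rewrite lt.
apply: leq_trans ht _; rewrite (expnM _ 2 6).
(* The height obtained is cubic in [#|V| ^ 2]. The two distinguished vertices make this square at
   least 4, so its sixth power dominates 64 times its cube. *)
have V2 : 2 <= #|V|.
  by apply/card_gt1P; exists vs, vt; split=> //; apply/eqP.
have : 4 <= #|V| ^ 2 by rewrite (@leq_exp2r 2 _ 2).
move: (#|V| ^ 2) => n n4.
have n3 : n ^ 3 = n * (n * n) by rewrite !expnS expn0 muln1.
have : 64 * n ^ 3 <= n ^ 6.
  by rewrite -[6]/(3 + 3) expnD leq_mul2r (@leq_exp2r 4 _ 3) ?n4 ?orbT.
rewrite n3; have : 0 < n * n by rewrite muln_gt0; lia.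
have : 4 * n <= n * n by rewrite leq_mul2r n4 orbT.
have : 4 * (n * n) <= n * (n * n) by rewrite leq_mul2r n4 orbT.
by move: (n ^ 6) => q; nia.
Qed.
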